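(* Let $Z=\{x_i\mid i\in\mathbb Z\}$ be a set indexed by $\mathbb Z$, let $F_+(Z)$ be the free group on $Z$ (written additively), let $\varepsilon\colon F_+(Z)\to\mathbb Z$ be the group epimorphism with $\varepsilon(x_i)=1$ for all $i$, and let $\theta$ be the automorphism of $F_+(Z)$ with $\theta(x_i)=x_{i+1}$ for all $i$. Then $$\{(w,\theta^{\varepsilon(w)})\mid w\in F_+(Z)\}\leq F_+(Z)\rtimes\mathrm{Aut}(F_+(Z))$$ is a regular subgroup, and the skew brace corresponding to it is the free right nilpotent skew brace of class at most $2$ on the one-element set $\{x_0\}$.
   Context: A (left) skew brace is a triple $(B,+,\circ)$ with $(B,+)$ and $(B,\circ)$ groups such that $a\circ(b+c)=a\circ b-a+a\circ c$ for all $a,b,c$. Put $\lambda_a(b)=-a+a\circ b$, $a*b=\lambda_a(b)-b$. Put $B^{(1)}=B$ and let $B^{(k+1)}$ be the subgroup of $(B,+)$ generated by all $a*b$ with $a\in B^{(k)}$, $b\in B$. $B$ is right nilpotent of class at most $2$ if $B^{(3)}=\{0\}$. The free right nilpotent skew brace of class at most $2$ on $\{x_0\}$ is the free object on $\{x_0\}$ in the category of these skew braces. For a group $(G,+)$ the holomorph $G\rtimes\mathrm{Aut}(G)$ acts on $G$ by $(a,f)\cdot b=a+f(b)$; a subgroup is regular if it acts freely and transitively on $G$. Skew brace structures $(G,+,\circ)$ with additive group $(G,+)$ correspond bijectively to regular subgroups of the holomorph: to the skew brace corresponds $\{(a,\lambda_a)\mid a\in G\}$, and conversely a regular subgroup $\{(a,f_a)\mid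 a\in G\}$ gives $a\circ b=a+f_a(b)$. *)

(* Defs.v *)
From HB Require Import structures.
From mathcomp Require Import all_boot all_order all_algebra.
From mathcomp Require Import boolp classical_sets.

Set Implicit Arguments.
Unset Strict Implicit.
Unset Printing Implicit Defensive.

Import Order.TTheory GRing.Theory.

Local Open Scope classical_set_scope.
Local Open Scope group_scope.

(* Groups are [groupType]s, which may be infinite and non-abelian.  The       *)
(* library writes them multiplicatively: in the additive group of a skew      *)
(* brace, x * y stands for x + y, x^-1 for -x and 1 for 0.                    *)

Definition expgz (G : groupType) (x : G) (n : int) : G :=
  match n with
  | Posz k => x ^+ k
  | Negz k => x ^- k.+1
  end.

Definition subgroup (G : groupType) (H : set G) : Prop :=
  [/\ H 1, (forall x y, H x -> H y -> H (x * y)) & (forall x, H x -> H x^-1)].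

Definition generated (G : groupType) (A : set G) : set G :=
  smallest (@subgroup G) A.

HB.mixin Record Group_isSkewBrace B of Group B := {
  circ : B -> B -> B;
  circ_one : B;
  circ_inv : B -> B;
  circA : associative circ;
  circ1b : left_id circ_one circ;
  circb1 : right_id circ_one circ;
  circVb : left_inverse circ_one circ_inv circ;
  circbV : right_inverse circ_one circ_inv circ;
  circ_brace : forall a b c : B, circ a (b * c) = circ a b * a^-1 * circ a c
}.

#[short(type="skewBraceType")]
HB.structure Definition SkewBrace := {B of Group_isSkewBrace B & Group B}.

Definition lambda (B : skewBraceType) (a b : B) : B := a^-1 * circ a b.

Definition star (B : skewBraceType) (a b : B) : B := lambda a b * b^-1.

(* [right_series B k] is B^(k) for k >= 1; the value at k = 0 is junk. *)
Fixpoint right_series (B : skewBraceType) (k : nat) : set B :=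
  match k with
  | 0 | 1 => setT
  | j.+1 => generated [set star a b | a in @right_series B j & b in setT]
  end.
Arguments right_series : clear implicits.

Definition right_nilpotent_le (B : skewBraceType) (c : nat) : Prop :=
  right_series B c.+1 = [set 1].

Definition skew_brace_morphism (B C : skewBraceType) (f : B -> C) : Prop :=
  {morph f : a b / a * b} /\ {morph f : a b / circ a b}.

(* (B, iota) is the free object on X in the category of right nilpotent skew  *)
(* braces of class at most c.                                                 *)
Definition free_right_nilpotent (c : nat) (X : Type) (B : skewBraceType)
    (iota : X -> B) : Prop :=
  right_nilpotent_le B c /\
  forall (C : skewBraceType) (f : X -> C), right_nilpotent_le C c ->
    exists! phi : B -> C,
      skew_brace_morphism phi /\ (forall x, phi (iota x) = f x).

Section Automorphisms.
Variable G : groupType.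

Record aut := Aut {
  aut_fun :> G -> G;
  aut_prop : `[< monoid.monoid_morphism aut_fun /\ bijective aut_fun >]
}.

HB.instance Definition _ := [isSub for aut_fun].
HB.instance Definition _ := [Choice of aut by <:].

Implicit Types f g h : aut.

Lemma autP f g : f =1 g -> f = g.
Proof. by move=> e; apply: val_inj; apply/funext. Qed.

Lemma autM f : {morph f : x y / x * y}.
Proof. by case: f => f /= /asboolP[[]]. Qed.

Lemma aut1 f : f 1 = 1.
Proof. by case: f => f /= /asboolP[[]]. Qed.

Lemma aut_bij f : bijective f.
Proof. by case: f => f /= /asboolP[]. Qed.

Fact aut_inv_ex f : exists g : G -> G, cancel f g /\ cancel g f.
Proof. by case: (aut_bij f) => g; exists g. Qed.

Definition aut_inv_fun f : G -> G := sval (cid (aut_inv_ex f)).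

Fact aut_invK f : cancel f (aut_inv_fun f) /\ cancel (aut_inv_fun f) f.
Proof. by rewrite /aut_inv_fun; case: cid. Qed.

Fact aut_one_prop : `[< monoid.monoid_morphism (@id G) /\ bijective (@id G) >].
Proof. by apply/asboolP; do !split=> //; exists id. Qed.

Fact aut_mul_prop f g : `[< monoid.monoid_morphism (f \o g) /\ bijective (f \o g) >].
Proof.
apply/asboolP; split; last exact: bij_comp (aut_bij f) (aut_bij g).
by split=> [|x y] /=; rewrite ?aut1 // !autM.
Qed.

Fact aut_inv_prop f :
  `[< monoid.monoid_morphism (aut_inv_fun f) /\ bijective (aut_inv_fun f) >].
Proof.
have [fK Kf] := aut_invK f; apply/asboolP; split; last by exists f.
by split=> [|x y]; apply: (can_inj fK); rewrite ?autM !Kf ?aut1.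
Qed.

Definition aut_one : aut := Aut aut_one_prop.
Definition aut_mul f g : aut := Aut (aut_mul_prop f g).
Definition aut_inv f : aut := Aut (aut_inv_prop f).

Fact aut_mulA : associative aut_mul.
Proof. by move=> f g h; apply: autP. Qed.
Fact aut_mul1 : left_id aut_one aut_mul.
Proof. by move=> f; apply: autP. Qed.
Fact aut_mulr1 : right_id aut_one aut_mul.
Proof. by move=> f; apply: autP. Qed.
Fact aut_mulV : left_inverse aut_one aut_inv aut_mul.
Proof. by move=> f; apply: autP => x /=; case: (aut_invK f). Qed.
Fact aut_mulrV : right_inverse aut_one aut_inv aut_mul.
Proof. by move=> f; apply: autP => x /=; case: (aut_invK f). Qed.

HB.instance Definition _ :=
  isGroup.Build aut aut_mulA aut_mul1 aut_mulr1 aut_mulV aut_mulrV.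

Lemma aut_mulE f g x : (f * g) x = f (g x). Proof. by []. Qed.
Lemma aut_invE f x : f (f^-1 x) = x.
Proof. by rewrite -aut_mulE mulgV. Qed.

End Automorphisms.

Section Holomorph.
Variable G : groupType.

Record holomorph := Hol { hol_elt : G; hol_aut : aut G }.

Definition hol_pair (s : holomorph) := (hol_elt s, hol_aut s).
Definition pair_hol (p : G * aut G) := Hol p.1 p.2.
Fact hol_pairK : cancel hol_pair pair_hol. Proof. by case. Qed.
HB.instance Definition _ := Choice.copy holomorph (can_type hol_pairK).

Implicit Types s t : holomorph.

Definition hol_one : holomorph := Hol 1 1.
Definition hol_mul s t : holomorph :=
  Hol (hol_elt s * hol_aut s (hol_elt t)) (hol_aut s * hol_aut t).
Definition hol_inv s : holomorph :=
  Hol ((hol_aut s)^-1 (hol_elt s)^-1) (hol_aut s)^-1.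

Fact hol_mulA : associative hol_mul.
Proof. by move=> [a f] [b g] [c h]; congr Hol => /=; rewrite ?autM mulgA. Qed.
Fact hol_mul1 : left_id hol_one hol_mul.
Proof. by move=> [a f]; congr Hol => /=; rewrite mul1g. Qed.
Fact hol_mulr1 : right_id hol_one hol_mul.
Proof. by move=> [a f]; congr Hol => /=; rewrite ?aut1 mulg1. Qed.
Fact hol_mulV : left_inverse hol_one hol_inv hol_mul.
Proof.
move=> [a f]; congr Hol; last exact: mulVg.
by rewrite [LHS](esym (autM f^-1 _ _)) mulVg aut1.
Qed.
Fact hol_mulrV : right_inverse hol_one hol_inv hol_mul.
Proof. move=> [a f]; congr Hol; last exact: mulgV.
by rewrite [X in _ * X](aut_invE f) mulgV. Qed.

HB.instance Definition _ :=
  isGroup.Build holomorph hol_mulA hol_mul1 hol_mulr1 hol_mulV hol_mulrV.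

Definition hol_act s (b : G) : G := hol_elt s * hol_aut s b.

Lemma hol_act1 b : hol_act 1 b = b.
Proof. by rewrite /hol_act mul1g. Qed.

Lemma hol_actM s t b : hol_act (s * t) b = hol_act s (hol_act t b).
Proof. by rewrite /hol_act autM mulgA. Qed.

Record regular_subgroup (S : set holomorph) : Prop := RegularSubgroup {
  regular_subgroupP : subgroup S;
  regular_free : forall s b, S s -> hol_act s b = b -> s = 1;
  regular_transitive : forall b c, exists2 s, S s & hol_act s b = c
}.

End Holomorph.

Section BraceOfRegular.
Variables (G : groupType) (S : set (holomorph G)) (regS : regular_subgroup S).

Fact regular_aut_ex (a : G) : exists f : aut G, S (Hol a f).
Proof.
have [[b f] Ss /= <-] := regular_transitive regS 1 a.
by exists f; rewrite /hol_act /= aut1 mulg1.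
Qed.

Definition regular_aut (a : G) : aut G := sval (cid (regular_aut_ex a)).

Lemma regular_autP a : S (Hol a (regular_aut a)).
Proof. by rewrite /regular_aut; case: cid. Qed.

Lemma regular_aut_uniq a f : S (Hol a f) -> regular_aut a = f.
Proof.
case: regS => [[_ SM SV] Sfree _] Sf; pose s := Hol a (regular_aut a).
suff /mulg1_eq : (Hol a f)^-1 * s = 1 by rewrite invgK => -[].
apply: (Sfree _ 1); first exact: SM (SV _ Sf) (regular_autP a).
have e : hol_act s 1 = hol_act (Hol a f) 1 by rewrite /hol_act /= !aut1.
by rewrite hol_actM e -hol_actM mulVg hol_act1.
Qed.

Definition brace_of_regular of regular_subgroup S : Type := G.

HB.instance Definition _ := Group.copy (brace_of_regular regS) G.

Definition regular_circ (a b : G) : G := a * regular_aut a b.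
Definition regular_circ_inv (a : G) : G := (regular_aut a)^-1 a^-1.

Lemma regular_aut1 : regular_aut 1 = 1.
Proof. by apply: regular_aut_uniq; case: regS => -[]. Qed.

Lemma regular_aut_circ a b :
  regular_aut (regular_circ a b) = regular_aut a * regular_aut b.
Proof.
apply: regular_aut_uniq; case: regS => -[_ SM _] _ _.
exact: SM (regular_autP a) (regular_autP b).
Qed.

Lemma regular_aut_inv a : regular_aut (regular_circ_inv a) = (regular_aut a)^-1.
Proof.
by apply: regular_aut_uniq; case: regS => -[_ _ SV] _ _; exact: SV (regular_autP a).
Qed.

Fact regular_circA : associative regular_circ.
Proof.
move=> a b c; rewrite [RHS]/(_ * regular_aut (regular_circ a b) c).
by rewrite regular_aut_circ /regular_circ autM mulgA.
Qed.
Fact regular_circ1 : left_id 1 regular_circ.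
Proof. by move=> a; rewrite /regular_circ regular_aut1 mul1g. Qed.
Fact regular_circr1 : right_id 1 regular_circ.
Proof. by move=> a; rewrite /regular_circ aut1 mulg1. Qed.
Fact regular_circV : left_inverse 1 regular_circ_inv regular_circ.
Proof.
by move=> a; rewrite /regular_circ regular_aut_inv /regular_circ_inv -autM mulVg aut1.
Qed.
Fact regular_circrV : right_inverse 1 regular_circ_inv regular_circ.
Proof. by move=> a; rewrite /regular_circ aut_invE mulgV. Qed.
Fact regular_circ_brace a b c :
  regular_circ a (b * c) = regular_circ a b * a^-1 * regular_circ a c.
Proof. by rewrite /regular_circ autM -!mulgA mulKg. Qed.

HB.instance Definition _ := Group_isSkewBrace.Build (brace_of_regular regS)
  regular_circA regular_circ1 regular_circr1 regular_circV regular_circrV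
  regular_circ_brace.

(* That is, S = {(a, lambda_a)}. *)
Lemma mem_brace_of_regular (a : G) (f : aut G) :
  S (Hol a f) <->
  f =1 (lambda (a : brace_of_regular regS) : brace_of_regular regS -> _).
Proof.
have lamE b : lambda (a : brace_of_regular regS) b = regular_aut a b.
  exact: (mulKg a).
split=> [Sf b | fE]; first by rewrite lamE (regular_aut_uniq Sf).
suff -> : f = regular_aut a by exact: regular_autP.
by apply: autP => b; rewrite fE lamE.
Qed.

End BraceOfRegular.

Section FreeGroup.
Variable X : choiceType.

(* Elements are reduced words; (x, true) is the letter x and (x, false) its
   inverse. *)
Definition letter_inv (a : X * bool) : X * bool := (a.1, ~~ a.2).
Definition reduced (w : seq (X * bool)) : bool :=
  sorted [rel a b | b != letter_inv a] w.

Record freeGroup := FreeGroup {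
  word :> seq (X * bool);
  word_reduced : reduced word
}.

HB.instance Definition _ := [isSub for word].
HB.instance Definition _ := [Choice of freeGroup by <:].

Implicit Types (a b : X * bool) (v w : seq (X * bool)).

Definition push a w : seq (X * bool) :=
  if w is b :: w' then if b == letter_inv a then w' else a :: w else [:: a].

Definition reduced_cat v w : seq (X * bool) := foldr push w v.

Definition word_inv w : seq (X * bool) := rev (map letter_inv w).

Lemma letter_invK : involutive letter_inv.
Proof. by case=> x b; rewrite /letter_inv /= negbK. Qed.

Lemma reduced_behead a w : reduced (a :: w) -> reduced w.
Proof. exact: path_sorted. Qed.

Lemma push_reduced a w : reduced w -> reduced (push a w).
Proof.
case: w => //= b w; case: ifP => [_|ba]; first exact: reduced_behead.
by rewrite /reduced /= ba.
Qed.

Lemma pushE a w : reduced (a :: w) -> push a w = a :: w.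
Proof. by case: w => //= b w /andP[/negPf->]. Qed.

Lemma pushK a w : reduced w -> push (letter_inv a) (push a w) = w.
Proof.
case: w => [|b w] rw; first by rewrite /= letter_invK eqxx.
rewrite [push a _]/=; case: ifP => [/eqP ba|_].
  by rewrite -ba pushE.
by rewrite /= letter_invK eqxx.
Qed.

Lemma reduced_cat_reduced v w : reduced w -> reduced (reduced_cat v w).
Proof. by move=> rw; elim: v => //= a v; apply: push_reduced. Qed.

Lemma reduced_cat0 w : reduced w -> reduced_cat w [::] = w.
Proof.
elim: w => //= a w IHw rw.
by rewrite IHw ?pushE // (reduced_behead rw).
Qed.

Lemma push_cat a v w : reduced v -> reduced w ->
  reduced_cat (push a v) w = push a (reduced_cat v w).
Proof.
case: v => //= b v rv rw; case: ifP => // /eqP ->.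
by rewrite -{1}(letter_invK a) pushK // reduced_cat_reduced.
Qed.

Lemma reduced_catA u v w : reduced v -> reduced w ->
  reduced_cat u (reduced_cat v w) = reduced_cat (reduced_cat u v) w.
Proof.
move=> rv rw; elim: u => //= a u ->.
by rewrite push_cat // reduced_cat_reduced.
Qed.

Lemma word_inv_reduced w : reduced w -> reduced (word_inv w).
Proof.
rewrite /reduced /word_inv rev_sorted sorted_map; apply: sub_sorted => a b /=.
by apply: contra => /eqP->; rewrite letter_invK.
Qed.

Lemma word_invV w : reduced w -> reduced_cat (word_inv w) w = [::].
Proof.
rewrite /word_inv; elim: w => //= a w IHw rw.
rewrite rev_cons /reduced_cat foldr_rcons -[X in foldr _ X]/(push _ (a :: w)).
by rewrite -(pushE rw) pushK; [apply: IHw|]; apply: reduced_behead rw.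
Qed.

Lemma word_invK : involutive word_inv.
Proof.
by move=> w; rewrite /word_inv map_rev revK mapK //; apply: letter_invK.
Qed.

Definition fg_one : freeGroup := @FreeGroup [::] isT.
Definition fg_mul (u v : freeGroup) : freeGroup :=
  FreeGroup (reduced_cat_reduced u (word_reduced v)).
Definition fg_inv (u : freeGroup) : freeGroup :=
  FreeGroup (word_inv_reduced (word_reduced u)).

Fact fg_mulA : associative fg_mul.
Proof.
by move=> u v w; apply/val_inj/reduced_catA; apply: word_reduced.
Qed.
Fact fg_mul1 : left_id fg_one fg_mul.
Proof. by move=> u; apply/val_inj. Qed.
Fact fg_mulr1 : right_id fg_one fg_mul.
Proof. by move=> u; apply/val_inj/reduced_cat0/word_reduced. Qed.
Fact fg_mulV : left_inverse fg_one fg_inv fg_mul.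
Proof. by move=> u; apply/val_inj/word_invV/word_reduced. Qed.
Fact fg_mulrV : right_inverse fg_one fg_inv fg_mul.
Proof.
move=> u; apply/val_inj; rewrite /= -{1}(word_invK u).
exact/word_invV/word_inv_reduced/word_reduced.
Qed.

HB.instance Definition _ :=
  isGroup.Build freeGroup fg_mulA fg_mul1 fg_mulr1 fg_mulV fg_mulrV.

Definition fg_gen (x : X) : freeGroup := @FreeGroup [:: (x, true)] isT.

Section Lift.
Variables (G : groupType) (f : X -> G).

Definition letter_val a : G := if a.2 then f a.1 else (f a.1)^-1.

Definition fg_lift (u : freeGroup) : G := \prod_(a <- word u) letter_val a.

Lemma letter_valV a : letter_val (letter_inv a) = (letter_val a)^-1.
Proof. by case: a => x []; rewrite /letter_val //= invgK. Qed.

Lemma push_val a w :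
  \prod_(b <- push a w) letter_val b = letter_val a * \prod_(b <- w) letter_val b.
Proof.
case: w => [|b w] /=; first by rewrite big_seq1 big_nil mulg1.
case: eqP => [->|_]; last by rewrite big_cons.
by rewrite big_cons letter_valV mulVKg.
Qed.

Lemma fg_liftM : {morph fg_lift : u v / u * v}.
Proof.
move=> [u ru] [v rv]; rewrite /fg_lift /=.
elim: u {ru} => [|a u IHu] /=; first by rewrite big_nil mul1g.
by rewrite push_val IHu big_cons mulgA.
Qed.

Lemma fg_lift1 : fg_lift 1 = 1. Proof. by rewrite /fg_lift big_nil. Qed.

Lemma fg_lift_gen x : fg_lift (fg_gen x) = f x.
Proof. by rewrite /fg_lift big_seq1. Qed.

Lemma fg_lift_uniq (h : freeGroup -> G) :
  {morph h : u v / u * v} -> (forall x, h (fg_gen x) = f x) -> h =1 fg_lift.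
Proof.
move=> hM hf; have h1 : h 1 = 1 by apply: (mulgI (h 1)); rewrite -hM !mulg1.
have hV u : h u^-1 = (h u)^-1 by apply: (mulgI (h u)); rewrite -hM !mulgV.
case=> w; elim: w => [|a w IHw] rw.
  by rewrite /fg_lift /= big_nil -h1; congr h; apply: val_inj.
have rw' := reduced_behead rw.
have [ra ha] : exists ra : reduced [:: a], h (FreeGroup ra) = letter_val a.
  exists isT; rewrite /letter_val; case: a {rw} => x [] /=.
    by rewrite -hf; congr h; apply: val_inj.
  by rewrite -hf -hV; congr h; apply: val_inj.
have -> : FreeGroup rw = FreeGroup ra * FreeGroup rw'.
  by apply: val_inj; rewrite /= pushE.
by rewrite hM ha IHw /fg_lift /= push_val.
Qed.

End Lift.

(* The sum of the exponents of the letters: the homomorphism to the integers  *)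
(* that maps every generator to 1.                                            *)
Definition exponent_sum (u : freeGroup) : int :=
  (\sum_(a <- word u) (if a.2 then 1 else -1))%R.

Lemma exponent_sumM (u v : freeGroup) :
  exponent_sum (u * v) = (exponent_sum u + exponent_sum v)%R.
Proof.
case: u v => [u ru] [v rv]; rewrite /exponent_sum /=.
elim: u {ru} => [|a u IHu] /=; first by rewrite big_nil add0r.
rewrite big_cons -addrA -IHu; case: (reduced_cat u v) => [|b w] /=.
  by rewrite big_seq1 big_nil addr0.
case: eqP => [->|_]; last by rewrite big_cons.
by rewrite big_cons /=; case: (a.2); rewrite addrA ?subrr ?addNr add0r.
Qed.

Lemma exponent_sum_gen x : exponent_sum (fg_gen x) = 1%R.
Proof. by rewrite /exponent_sum big_seq1. Qed.

End FreeGroup.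

Definition translate (k : int) : freeGroup int -> freeGroup int :=
  fg_lift (fun i => fg_gen (i + k)%R).

Lemma translate_gen k i : translate k (fg_gen i) = fg_gen (i + k)%R.
Proof. exact: fg_lift_gen. Qed.

Lemma translateK k l : (k + l = 0)%R -> cancel (translate k) (translate l).
Proof.
move=> kl0 u.
rewrite [RHS](fg_lift_uniq (h := id) (f := @fg_gen int) _ (fun=> erefl)) //.
apply: (fg_lift_uniq (h := translate l \o translate k)) => [v w|i] /=.
  by rewrite /translate !fg_liftM.
by rewrite !translate_gen -addrA kl0 addr0.
Qed.

Fact shift_prop :
  `[< monoid.monoid_morphism (translate 1%R) /\ bijective (translate 1%R) >].
Proof.
apply/asboolP; split; first by split; [apply: fg_lift1 | apply: fg_liftM].
by exists (translate (- 1)%R); apply: translateK; rewrite ?subrr ?addNr.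
Qed.

(* The automorphism x_i |-> x_(i+1) of the free group on the integers.        *)
Definition shift : aut (freeGroup int) := Aut shift_prop.

Lemma shift_gen i : shift (fg_gen i) = fg_gen (i + 1)%R.
Proof. exact: translate_gen. Qed.

(* Main.v *)
(* In a skew brace [C] with [C^(3) = 0], [lambda] is trivial on [C^(2)],
   hence [lambda_(k + b) = lambda_b] for [k] in [C^(2)]; since
   [lambda_a b = a * b + b], this gives [lambda_(lambda_a b) = lambda_b], so
   that [lambda] is a homomorphism on [(C, +)] too.  For [c] in [C], sending
   [x_i] to [lambda_c^i c] therefore defines an additive homomorphism [phi] with
   [lambda_(phi u) = lambda_c^(eps u)], which is exactly what makes it a
   morphism of skew braces; it is the only one because [x_i = theta^i x_0]. *)

Require Import Defs.
From mathcomp Require Import all_boot all_order all_algebra.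
From mathcomp Require Import boolp classical_sets.

Set Implicit Arguments.
Unset Strict Implicit.
Unset Printing Implicit Defensive.

Import GRing.Theory.

Local Open Scope classical_set_scope.
Local Open Scope group_scope.

(** * Integer powers in a group *)

Lemma expgz1D (G : groupType) (x : G) (k : int) :
  expgz x (1 + k)%R = x * expgz x k.
Proof.
case: k => [n|[|n]]; first by rewrite -PoszD add1n /= expgS.
  by rewrite -[(1 + _)%R]/(0 : int)%R /= expg1 mulgV.
have -> : (1 + Negz n.+1)%R = Negz n.
  by rewrite !NegzE -[n.+2]add1n PoszD opprD addNKr.
by rewrite /= [in RHS]expgSr invgM mulVKg.
Qed.

Lemma expgzN1D (G : groupType) (x : G) (k : int) :
  expgz x (- 1 + k)%R = x^-1 * expgz x k.
Proof. by apply: (mulgI x); rewrite mulVKg -expgz1D addrA subrr add0r. Qed.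

Lemma int_succ_pred_ind (P : int -> Prop) :
  P 0%R -> (forall k, P k -> P (1 + k)%R) -> (forall k, P k -> P (- 1 + k)%R) ->
  forall k, P k.
Proof.
move=> P0 PS PV; elim=> // n IHn; first by rewrite -add1n PoszD; apply: PS.
by rewrite -add1n PoszD opprD; apply: PV.
Qed.

Lemma expgzD (G : groupType) (x : G) (k l : int) :
  expgz x (k + l)%R = expgz x k * expgz x l.
Proof.
elim/int_succ_pred_ind: k => [|k IHk|k IHk]; first by rewrite add0r mul1g.
  by rewrite -addrA !expgz1D IHk mulgA.
by rewrite -addrA !expgzN1D IHk mulgA.
Qed.

Lemma expgzN (G : groupType) (x : G) (k : int) :
  expgz x (- k)%R = (expgz x k)^-1.
Proof. by apply: (mulgI (expgz x k)); rewrite -expgzD subrr mulgV. Qed.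

(** Meant for [H] a set of automorphisms preserving some function, so that invariance under one of
    them passes to its negative powers too. *)
Lemma expgz_subgroup (G : groupType) (H : set G) (x : G) (k : int) :
  subgroup H -> H x -> H (expgz x k).
Proof.
case=> H1 HM HV Hx; elim/int_succ_pred_ind: k => // k IHk.
  by rewrite expgz1D; apply: HM.
by rewrite expgzN1D; apply: HM => //; apply: HV.
Qed.

Lemma expgz_intertwine (G H : groupType) (f : aut G) (g : aut H) (phi : G -> H)
    (k : int) : (forall v, phi (f v) = g (phi v)) ->
  forall v, phi (expgz f k v) = expgz g k (phi v).
Proof.
move=> fg; elim/int_succ_pred_ind: k => [//|k IHk|k IHk] v.
  by rewrite !expgz1D !aut_mulE fg IHk.
rewrite !expgzN1D !aut_mulE -IHk -[in RHS](aut_invE f (expgz f k v)) fg.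
by rewrite -[in RHS]aut_mulE mulVg.
Qed.

(** * Free groups: generation, exponent sum, shift *)

Lemma freeGroup_subgroupT (X : choiceType) (H : set (freeGroup X)) :
  subgroup H -> (forall x, H (fg_gen x)) -> forall u, H u.
Proof.
case=> H1 HM HV Hgen [w]; elim: w => [|a w IHw] rw.
  by rewrite (_ : FreeGroup rw = 1) //; apply: val_inj.
have rw' := reduced_behead rw.
have [ra Ha] : exists ra : reduced [:: a], H (FreeGroup ra).
  exists isT; case: a {rw} => x [].
    by rewrite (_ : FreeGroup _ = fg_gen x) //; apply: val_inj.
  rewrite (_ : FreeGroup _ = (fg_gen x)^-1); first exact: HV.
  exact: val_inj.
have -> : FreeGroup rw = FreeGroup ra * FreeGroup rw'.
  by apply: val_inj; rewrite /= pushE.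
exact: HM.
Qed.

Lemma exponent_sum1 (X : choiceType) : exponent_sum (1 : freeGroup X) = 0%R.
Proof. by rewrite /exponent_sum big_nil. Qed.

Lemma exponent_sumV (X : choiceType) (u : freeGroup X) :
  exponent_sum u^-1 = (- exponent_sum u)%R.
Proof.
apply: (addrI (exponent_sum u)).
by rewrite -exponent_sumM mulgV exponent_sum1 subrr.
Qed.

Lemma expgz_exponent_sum (X : choiceType) (G : groupType) (x : G)
    (u : freeGroup X) :
  expgz x (exponent_sum u) = fg_lift (fun=> x) u.
Proof.
apply: (fg_lift_uniq (h := fun u => expgz x (exponent_sum u))) => [v w|y].
  by rewrite exponent_sumM expgzD.
by rewrite exponent_sum_gen /= expg1.
Qed.

(** Two subgroup arguments: the automorphisms preserving exponent sums form a group, and the words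
    whose exponent sum [shift] preserves form a subgroup containing the generators. *)
Lemma exponent_sum_shift (k : int) (u : freeGroup int) :
  exponent_sum (expgz shift k u) = exponent_sum u.
Proof.
pose H (f : aut (freeGroup int)) :=
  forall v, exponent_sum (f v) = exponent_sum v.
apply: (@expgz_subgroup _ H); first split=> [v //|f g Hf Hg v|f Hf v].
- by rewrite aut_mulE Hf.
- by rewrite -Hf aut_invE.
apply: freeGroup_subgroupT => [|i]; last by rewrite shift_gen !exponent_sum_gen.
split=> [|v w|v]; first by rewrite aut1.
  by rewrite autM !exponent_sumM => -> ->.
have -> : shift v^-1 = (shift v)^-1.
  by apply: (mulgI (shift v)); rewrite -autM !mulgV aut1.
by rewrite !exponent_sumV => ->.
Qed.

Lemma expgz_shift_gen0 (k : int) : expgz shift k (fg_gen 0%R) = fg_gen k.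
Proof.
elim/int_succ_pred_ind: k => // k IHk.
  by rewrite expgz1D aut_mulE IHk shift_gen addrC.
rewrite expgzN1D aut_mulE IHk -[in LHS](subrK 1%R k) -shift_gen -aut_mulE mulVg.
by rewrite addrC.
Qed.

(** * The map [lambda] and right nilpotency of class at most 2 *)

Section LambdaAut.
Variable C : skewBraceType.
Implicit Types a b c : C.

(** The brace identity at [b = c = 1] reads [circ a 1 = circ a 1 * a^-1 * circ a 1]; cancel
    [circ a 1]. This makes the two neutral elements coincide. *)
Lemma circb_add1 a : circ a 1 = a.
Proof.
have /eqP := circ_brace a 1 1; rewrite mulg1 -mulgA -{1}[circ a 1]mulg1.
by move/eqP/mulgI/(congr1 (fun x => a * x)); rewrite mulg1 mulVKg.
Qed.

Lemma circ_oneE : circ_one = 1 :> C.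
Proof. by rewrite -(circb_add1 circ_one) circ1b. Qed.

Lemma circE a b : circ a b = a * lambda a b.
Proof. by rewrite /lambda mulVKg. Qed.

Lemma lambdaM a : {morph lambda a : b c / b * c}.
Proof. by move=> b c; rewrite /lambda circ_brace !mulgA. Qed.

Lemma lambda_circ a b c : lambda (circ a b) c = lambda a (lambda b c).
Proof.
apply: (mulgI (circ a b)); rewrite -circE -circA [in RHS]circE -mulgA -lambdaM.
by rewrite -!circE.
Qed.

Lemma lambda1 b : lambda 1 b = b.
Proof. by rewrite /lambda invg1 mul1g -circ_oneE circ1b. Qed.

Fact lambda_aut_prop a :
  `[< monoid.monoid_morphism (@lambda C a) /\ bijective (@lambda C a) >].
Proof.
apply/asboolP; split.
  by split; [rewrite /lambda circb_add1 mulVg | apply: lambdaM].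
exists (lambda (circ_inv a)) => b; rewrite -lambda_circ.
  by rewrite circVb circ_oneE lambda1.
by rewrite circbV circ_oneE lambda1.
Qed.

Definition lambda_aut a : aut C := Aut (lambda_aut_prop a).

Lemma lambda_aut_circ a b : lambda_aut (circ a b) = lambda_aut a * lambda_aut b.
Proof. by apply: autP => c; apply: lambda_circ. Qed.

Lemma lambda_aut_inv a b : lambda a ((lambda_aut a)^-1 b) = b.
Proof. exact: (aut_invE (lambda_aut a)). Qed.

Lemma lambda_star : right_nilpotent_le C 2 ->
  forall a b, lambda_aut (star a b) = 1.
Proof.
(* Multiplied by [c^-1], the claim says that [star (star a b) c], an element of the third term of
   the series, is trivial. *)
move=> C3 a b; apply: autP => c; apply: (mulIg c^-1).
rewrite [RHS](mulgV c).
suff : right_series C 3 (star (star a b) c) by rewrite C3.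
apply: sub_gen_smallest; exists (star a b); last by exists c.
by apply: sub_gen_smallest; exists a => //; exists b.
Qed.

Lemma lambda_aut_lambda : right_nilpotent_le C 2 ->
  forall a b, lambda_aut (lambda a b) = lambda_aut b.
Proof.
move=> C3 a b; have k1 := lambda_star C3 a b.
(* As [lambda (star a b)] is the identity, adding [b] to [star a b] is the same as circling. *)
have -> : lambda a b = circ (star a b) b.
  rewrite circE -[lambda (star a b) b]/(lambda_aut (star a b) b) k1.
  by rewrite /star mulgVK.
by rewrite lambda_aut_circ k1 mul1g.
Qed.

(** Writing [b = lambda a d] gives [a * b = circ a d], and [d] has the same [lambda] as [b]. *)
Lemma lambda_aut_morph : right_nilpotent_le C 2 ->
  {morph lambda_aut : a b / a * b}.
Proof.
move=> C3 a b; rewrite -{1}(lambda_aut_inv a b) -circE lambda_aut_circ.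
by rewrite -(lambda_aut_lambda C3 a ((lambda_aut a)^-1 b)) lambda_aut_inv.
Qed.

Lemma right_series_subgroup k : subgroup (right_series C k).
Proof.
case: k => [|[|k]] //.
split=> [|x y Hx Hy|x Hx] A AP; case: (AP) => -[A1 AM AV] _.
- by [].
- by apply: AM; [apply: Hx | apply: Hy].
- by apply: AV; apply: Hx.
Qed.

(** The second term of the series lies in [K], so [lambda] is trivial on it and all generators of
    the third term are 1. It is applied to the kernel of the exponent sum. *)
Lemma right_nilpotent_le2 (K : set C) : subgroup K ->
  (forall a b, K (star a b)) -> (forall a b, K a -> lambda a b = b) ->
  right_nilpotent_le C 2.
Proof.
move=> KG Kstar Klam; apply/seteqP; split=> [|_ ->].
  apply: smallest_sub => [|_ [a B2a] [b _ <-]].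
    by split=> [//|_ _ -> ->|_ ->]; rewrite ?mulg1 ?invg1.
  rewrite /= /star Klam ?mulgV //.
  by apply: smallest_sub B2a => // _ [c _] [d _ <-].
by case: (right_series_subgroup 3).
Qed.

End LambdaAut.

(** * The regular subgroup and its skew brace *)

Section FreeBrace.

Let S : set (holomorph (freeGroup int)) :=
  [set Hol w (expgz shift (exponent_sum w)) | w in [set: freeGroup int]].

Lemma shift_regular : regular_subgroup S.
Proof.
have memS w : S (Hol w (expgz shift (exponent_sum w))) by exists w.
split; first split.
- by have := memS 1; rewrite exponent_sum1.
(* Shifting [w] keeps its exponent sum, so the first component of the product has the sum of both
   exponents, as the second one demands. *)
- move=> _ _ [v _ <-] [w _ <-].
  rewrite -[_ * _]/(hol_mul _ _) /hol_mul /= -expgzD.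
  have := memS (v * expgz shift (exponent_sum v) w).
  by rewrite exponent_sumM exponent_sum_shift.
- move=> _ [w _ <-].
  have := memS (expgz shift (- exponent_sum w)%R w^-1).
  by rewrite exponent_sum_shift exponent_sumV expgzN.
- move=> _ b [w _ <-]; rewrite /hol_act /= => wb.
  (* Exponent sums in [wb] give 0 for [w]; then its automorphism is the identity and [w] cancels to
     1. *)
  have w0 : exponent_sum w = 0%R.
    apply: (addIr (exponent_sum b)); rewrite add0r -[in RHS]wb.
    by rewrite exponent_sumM exponent_sum_shift.
  by move: wb; rewrite w0 /= -[RHS]mul1g => /mulIg ->.
(* Exponent sums force the power [k] of the shift before [w] is known; then [w] is solved for. *)
move=> b c; pose k := (exponent_sum c - exponent_sum b)%R.
pose w := c * (expgz shift k b)^-1.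
have wk : exponent_sum w = k.
  by rewrite exponent_sumM exponent_sumV exponent_sum_shift.
exists (Hol w (expgz shift (exponent_sum w))) => //.
by rewrite /hol_act /= wk mulgVK.
Qed.

Let F := brace_of_regular shift_regular.

Lemma shift_lambdaE (u v : F) :
  lambda u v = expgz shift (exponent_sum (u : freeGroup int)) v.
Proof.
symmetry; have [+ _] := mem_brace_of_regular shift_regular u
  (expgz shift (exponent_sum (u : freeGroup int))); apply.
by exists u.
Qed.

Lemma shift_right_nilpotent : right_nilpotent_le F 2.
Proof.
apply: (@right_nilpotent_le2 F
    [set u | exponent_sum (u : freeGroup int) = 0%R]).
- split=> [|u v /= u0 v0|u /= u0]; first exact: exponent_sum1.
    by rewrite (exponent_sumM u v) u0 v0.
  by rewrite (@exponent_sumV _ u) u0.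
- move=> u v; rewrite /= /star shift_lambdaE.
  rewrite (exponent_sumM (expgz shift _ v)) exponent_sumV exponent_sum_shift.
  exact: subrr.
- by move=> u v /= u0; rewrite shift_lambdaE u0.
Qed.

(** * The universal property *)

Section Extension.
Variables (C : skewBraceType) (c : C).
Hypothesis C3 : right_nilpotent_le C 2.

Definition brace_lift : freeGroup int -> C :=
  fg_lift (fun i => expgz (lambda_aut c) i c).

Lemma brace_liftM : {morph brace_lift : u v / u * v}.
Proof. exact: fg_liftM. Qed.

Lemma brace_lift_gen i : brace_lift (fg_gen i) = expgz (lambda_aut c) i c.
Proof. exact: fg_lift_gen. Qed.

Lemma lambda_aut_expgz i b :
  lambda_aut (expgz (lambda_aut c) i b) = lambda_aut b.
Proof.
pose H (f : aut C) := forall d, lambda_aut (f d) = lambda_aut d.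
apply: (@expgz_subgroup _ H) => [|d]; last exact: lambda_aut_lambda.
split=> [//|f g Hf Hg d|f Hf d]; first by rewrite aut_mulE Hf.
by rewrite -Hf aut_invE.
Qed.

Lemma lambda_brace_lift u :
  lambda_aut (brace_lift u) = expgz (lambda_aut c) (exponent_sum u).
Proof.
rewrite expgz_exponent_sum.
apply: (fg_lift_uniq (h := fun u => lambda_aut (brace_lift u))) => [v w|i].
  by rewrite brace_liftM lambda_aut_morph.
by rewrite brace_lift_gen lambda_aut_expgz.
Qed.

(** Both sides are homomorphisms in [v] sending the generator of index [i] to
    [expgz (lambda_aut c) (1 + i) c]. *)
Lemma brace_lift_shift v :
  brace_lift (shift v) = lambda_aut c (brace_lift v).
Proof.
pose g i := expgz (lambda_aut c) (1 + i)%R c.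
transitivity (fg_lift g v); last symmetry.
  apply: (fg_lift_uniq (h := fun u => brace_lift (shift u))) => [u w|i].
    by rewrite autM brace_liftM.
  by rewrite shift_gen brace_lift_gen addrC.
apply: (fg_lift_uniq (h := fun u => lambda_aut c (brace_lift u))) => [u w|i].
  by rewrite brace_liftM autM.
by rewrite brace_lift_gen /g expgz1D.
Qed.

Lemma brace_lift_morph : skew_brace_morphism (brace_lift : F -> C).
Proof.
split; first exact: brace_liftM.
move=> u v; rewrite !circE shift_lambdaE [LHS]brace_liftM; congr (_ * _).
(* Equivariance turns the power of [shift] into the same power of [lambda_aut c], which is the
   [lambda] of the image of [u]. *)
rewrite (expgz_intertwine _ brace_lift_shift).
by rewrite -lambda_brace_lift.
Qed.

Lemma brace_lift_uniq (psi : F -> C) : skew_brace_morphism psi ->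
  psi (fg_gen 0%R : freeGroup int) = c -> psi =1 brace_lift.
Proof.
case=> psiM psi_circ psi0; apply: fg_lift_uniq => // i.
(* The generator of index 0 has exponent sum 1, so its [lambda] is [shift] itself; apply [psi] to
   its circle product with [v] and cancel [c]. *)
have psi_shift v : psi (shift v) = lambda_aut c (psi v).
  apply: (mulgI c); rewrite -circE -[in RHS]psi0 -psi_circ circE shift_lambdaE.
  by rewrite exponent_sum_gen psiM psi0.
rewrite -expgz_shift_gen0.
by rewrite (@expgz_intertwine (freeGroup int) C _ _ psi i psi_shift) psi0.
Qed.

End Extension.
End FreeBrace.

Theorem theorem5p7 :
  let S : set (holomorph (freeGroup int)) :=
    [set Hol w (expgz shift (exponent_sum w)) | w in [set: freeGroup int]] in
  exists regS : regular_subgroup S,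
    free_right_nilpotent 2
      (fun _ : unit => fg_gen (0 : int)%R : brace_of_regular regS).
Proof.
move=> S; exists shift_regular; split; first exact: shift_right_nilpotent.
move=> C f C3; exists (brace_lift (f tt)); split.
  split; first exact: brace_lift_morph.
  by case; rewrite brace_lift_gen.
move=> psi [psiM psi0]; apply/funext => u; symmetry.
by apply: brace_lift_uniq; rewrite ?psi0.
Qed.
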